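(* Let $\mathcal{C}$ be a premodular fusion category and $\mathcal{D}\subset\mathcal{C}$ a Tannakian subcategory of $\mathcal{C}$ with $\mathrm{rank}(\mathcal{D})+2=\mathrm{rank}(\mathcal{C})$. Then at least one of the following is true: (1) $\mathcal{C}$ is symmetrically braided, (2) $\mathcal{D}\subsetneq C_\mathcal{C}(\mathcal{C})$ and $C_\mathcal{C}(\mathcal{C})$ is a maximal fusion subcategory of $\mathcal{C}$, or (3) $C_\mathcal{C}(\mathcal{C})\subset\mathcal{D}$.
   Context: Fusion categories are over $\mathbb{C}$; rank is the number of isomorphism classes of simple objects. A premodular fusion category is a braided fusion category equipped with a spherical structure. For a braided fusion category $\mathcal{C}$ with braiding $\sigma$, the symmetric center $C_\mathcal{C}(\mathcal{C})$ is the fusion subcategory of objects $X$ with $\sigma_{Y,X}\sigma_{X,Y}=\mathrm{id}_{X\otimes Y}$ for all $Y\in\mathcal{C}$; $\mathcal{C}$ is symmetrically braided if $C_\mathcal{C}(\mathcal{C})=\mathcal{C}$. A fusion subcategory of $\mathcal{C}$ is Tannakian if, with the braiding of $\mathcal{C}$, it is braided equivalent to $\mathrm{Rep}(G)$ with its standard symmetric braiding for some finite group $G$. A maximal fusion subcategory $\mathcal{E}\subset\mathcal{C}$ means a proper fusion subcategory of maximal possible rank, i.e. $\mathrm{rank}(\mathcal{E})+1=\mathrm{rank}(\mathcal{C})$. *)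

(* Defs.v *)
From HB Require Import structures.
From mathcomp Require Import all_boot all_order all_algebra.
From mathcomp Require Import all_fingroup mxrepresentation mxtens complex.
From mathcomp Require Import boolp classical_sets reals.

Set Implicit Arguments.
Unset Strict Implicit.
Unset Printing Implicit Defensive.

Import GRing.Theory.
Local Open Scope ring_scope.
Local Open Scope classical_set_scope.

Declare Scope cat_scope.
Delimit Scope cat_scope with cat.
Local Open Scope cat_scope.

(* Morphism spaces are finite-dimensional by typing.                          *)
Record linearCategory (K : fieldType) := LinearCategory {
  obj :> Type;
  hom : obj -> obj -> vectType K;
  idm : forall X, hom X X;
  comp : forall X Y Z, hom Y Z -> hom X Y -> hom X Z;
  comp_linear_l : forall X Y Z (f : hom X Y),
    linear (fun g : hom Y Z => comp g f);
  comp_linear_r : forall X Y Z (g : hom Y Z),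
    linear (fun f : hom X Y => comp g f);
  comp_assoc : forall X Y Z W (h : hom Z W) (g : hom Y Z) (f : hom X Y),
    comp h (comp g f) = comp (comp h g) f;
  comp_idl : forall X Y (f : hom X Y), comp (idm Y) f = f;
  comp_idr : forall X Y (f : hom X Y), comp f (idm X) = f }.

Arguments hom {K l} X Y.
Arguments idm {K l} X.
Arguments comp {K l X Y Z} g f.

Notation "g \oc f" := (comp g f)
  (at level 50, left associativity, format "g  \oc  f") : cat_scope.

Section LinearCategories.
Variables (K : fieldType) (C : linearCategory K).
Implicit Types X Y Z : C.

Definition inverse_pair X Y (f : hom X Y) (g : hom Y X) :=
  g \oc f = idm X /\ f \oc g = idm Y.

Definition is_iso X Y (f : hom X Y) := exists g, inverse_pair f g.

Definition isomorphic X Y := exists f : hom X Y, is_iso f.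

Definition mono X Y (f : hom X Y) :=
  forall W (u v : hom W X), f \oc u = f \oc v -> u = v.

Definition epi X Y (f : hom X Y) :=
  forall W (u v : hom Y W), u \oc f = v \oc f -> u = v.

Definition is_zero X :=
  forall Y, (forall f : hom X Y, f = 0) /\ (forall f : hom Y X, f = 0).

Definition is_kernel X Y (f : hom X Y) N (k : hom N X) :=
  f \oc k = 0 /\
  forall W (u : hom W X), f \oc u = 0 -> exists! v : hom W N, k \oc v = u.

Definition is_cokernel X Y (f : hom X Y) Q (q : hom Y Q) :=
  q \oc f = 0 /\
  forall W (u : hom Y W), u \oc f = 0 -> exists! v : hom Q W, v \oc q = u.

(* The empty direct sums (n = 0) are the zero objects.                        *)
Definition direct_sum n (s : 'I_n -> C) X :=
  exists (inj : forall i, hom (s i) X) (prj : forall i, hom X (s i)),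
    [/\ forall i, prj i \oc inj i = idm (s i),
        forall i j, i != j -> prj j \oc inj i = 0
      & \sum_i (inj i \oc prj i) = idm X].

Record abelian_category : Prop := AbelianCategory {
  direct_sum_exists : forall n (s : 'I_n -> C), exists X, direct_sum s X;
  kernel_exists : forall X Y (f : hom X Y),
    exists (N : C) (k : hom N X), is_kernel f k;
  cokernel_exists : forall X Y (f : hom X Y),
    exists (Q : C) (q : hom Y Q), is_cokernel f q;
  mono_normal : forall X Y (f : hom X Y), mono f ->
    exists (Z : C) (g : hom Y Z), is_kernel g f;
  epi_normal : forall X Y (f : hom X Y), epi f ->
    exists (Z : C) (g : hom Z X), is_cokernel g f }.

Definition simple_obj X :=
  ~ is_zero X /\
  forall Y (f : hom Y X), mono f -> is_zero Y \/ is_iso f.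

Definition semisimple_category :=
  forall X, exists (n : nat) (s : 'I_n -> C),
    (forall i, simple_obj (s i)) /\ direct_sum s X.

Definition num_simple_classes (n : nat) :=
  exists s : 'I_n -> C,
    [/\ forall i, simple_obj (s i),
        forall i j, isomorphic (s i) (s j) -> i = j
      & forall X, simple_obj X -> exists i, isomorphic X (s i)].

(* Junk value 0 when there are infinitely many classes of simple objects.     *)
Definition rank : nat := xget 0%N [set n | num_simple_classes n].

End LinearCategories.

Record monoidalCategory (K : fieldType) := MonoidalCategory {
  mon_cat :> linearCategory K;
  unit_obj : mon_cat;
  tens : mon_cat -> mon_cat -> mon_cat;
  tensm : forall (X X' Y Y' : mon_cat),
    hom X X' -> hom Y Y' -> hom (tens X Y) (tens X' Y');
  tensm_linear_l : forall (X X' Y Y' : mon_cat) (g : hom Y Y'),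
    linear (fun f : hom X X' => tensm f g);
  tensm_linear_r : forall (X X' Y Y' : mon_cat) (f : hom X X'),
    linear (fun g : hom Y Y' => tensm f g);
  tensm_id : forall (X Y : mon_cat),
    tensm (idm X) (idm Y) = idm (tens X Y);
  tensm_comp : forall (X X' X'' Y Y' Y'' : mon_cat)
      (f' : hom X' X'') (f : hom X X') (g' : hom Y' Y'') (g : hom Y Y'),
    tensm (f' \oc f) (g' \oc g) = tensm f' g' \oc tensm f g;
  assoc : forall X Y Z : mon_cat,
    hom (tens (tens X Y) Z) (tens X (tens Y Z));
  assocV : forall X Y Z : mon_cat,
    hom (tens X (tens Y Z)) (tens (tens X Y) Z);
  lunit : forall X : mon_cat, hom (tens unit_obj X) X;
  lunitV : forall X : mon_cat, hom X (tens unit_obj X);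
  runit : forall X : mon_cat, hom (tens X unit_obj) X;
  runitV : forall X : mon_cat, hom X (tens X unit_obj);
  assocK : forall X Y Z, inverse_pair (assoc X Y Z) (assocV X Y Z);
  lunitK : forall X, inverse_pair (lunit X) (lunitV X);
  runitK : forall X, inverse_pair (runit X) (runitV X);
  assoc_natural : forall (X X' Y Y' Z Z' : mon_cat)
      (f : hom X X') (g : hom Y Y') (h : hom Z Z'),
    assoc X' Y' Z' \oc tensm (tensm f g) h =
    tensm f (tensm g h) \oc assoc X Y Z;
  lunit_natural : forall (X Y : mon_cat) (f : hom X Y),
    lunit Y \oc tensm (idm unit_obj) f = f \oc lunit X;
  runit_natural : forall (X Y : mon_cat) (f : hom X Y),
    runit Y \oc tensm f (idm unit_obj) = f \oc runit X;
  pentagon : forall X Y Z W : mon_cat,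
    assoc X Y (tens Z W) \oc assoc (tens X Y) Z W =
    tensm (idm X) (assoc Y Z W) \oc assoc X (tens Y Z) W
      \oc tensm (assoc X Y Z) (idm W);
  triangle : forall X Y : mon_cat,
    tensm (idm X) (lunit Y) \oc assoc X unit_obj Y =
    tensm (runit X) (idm Y) }.

Arguments unit_obj {K m}.
Arguments tens {K m} X Y.
Arguments tensm {K m X X' Y Y'} f g.
Arguments assoc {K m} X Y Z.
Arguments assocV {K m} X Y Z.
Arguments lunit {K m} X.
Arguments lunitV {K m} X.
Arguments runit {K m} X.
Arguments runitV {K m} X.

Notation "X \ox Y" := (tens X Y)
  (at level 40, left associativity, format "X  \ox  Y") : cat_scope.
Notation "f \om g" := (tensm f g)
  (at level 40, left associativity, format "f  \om  g") : cat_scope.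

Record braidedCategory (K : fieldType) := BraidedCategory {
  br_mon :> monoidalCategory K;
  braid : forall X Y : br_mon, hom (X \ox Y) (Y \ox X);
  braid_iso : forall X Y, is_iso (braid X Y);
  braid_natural : forall (X X' Y Y' : br_mon) (f : hom X X') (g : hom Y Y'),
    braid X' Y' \oc (f \om g) = (g \om f) \oc braid X Y;
  hexagon_l : forall X Y Z : br_mon,
    assoc Y Z X \oc braid X (Y \ox Z) \oc assoc X Y Z =
    (idm Y \om braid X Z) \oc assoc Y X Z \oc (braid X Y \om idm Z);
  hexagon_r : forall X Y Z : br_mon,
    assocV Z X Y \oc braid (X \ox Y) Z \oc assocV X Y Z =
    (braid X Z \om idm Y) \oc assocV X Z Y \oc (idm X \om braid Y Z) }.

Arguments braid {K b} X Y.

Section Duality.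
Variables (K : fieldType) (C : monoidalCategory K).
Implicit Types X Y : C.

(* The zigzag identities for Y = X^* as a left dual of X.                     *)
Definition duality X Y (ev : hom (Y \ox X) unit_obj)
    (coev : hom unit_obj (X \ox Y)) :=
  runit X \oc (idm X \om ev) \oc assoc X Y X
    \oc (coev \om idm X) \oc lunitV X = idm X /\
  lunit Y \oc (ev \om idm Y) \oc assocV Y X Y
    \oc (idm Y \om coev) \oc runitV Y = idm Y.

Definition left_dual X Y :=
  exists (ev : hom (Y \ox X) unit_obj) (coev : hom unit_obj (X \ox Y)),
    duality ev coev.

Definition rigid :=
  forall X, (exists Y, left_dual X Y) /\ (exists Y, left_dual Y X).

Record fusion_category : Prop := FusionCategory {
  fusion_abelian : abelian_category C;
  fusion_semisimple : semisimple_category C;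
  fusion_finite : exists n, num_simple_classes C n;
  fusion_rigid : rigid;
  fusion_unit_simple : simple_obj (unit_obj : C) }.

End Duality.

Record leftDuals (K : fieldType) (C : monoidalCategory K) := LeftDuals {
  dual : C -> C;
  ev : forall X, hom (dual X \ox X) unit_obj;
  coev : forall X, hom unit_obj (X \ox dual X);
  dualP : forall X, duality (ev X) (coev X) }.

Section Spherical.
Variables (K : fieldType) (C : monoidalCategory K) (d : leftDuals C).
Implicit Types X Y : C.

Local Notation "X ^*" := (dual d X).

(* Hom(A (x) B, 1) -> Hom(A, B^* ).                                           *)
Definition transpose A B (e : hom (A \ox B) unit_obj) : hom A B^* :=
  lunit B^* \oc (e \om idm B^*) \oc assocV A B B^*
    \oc (idm A \om coev d B) \oc runitV A.

Definition dual_mor X Y (f : hom X Y) : hom Y^* X^* :=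
  transpose (ev d Y \oc (idm Y^* \om f)).

(* The canonical isomorphism Y^* (x) X^* -> (X (x) Y)^*.                      *)
Definition dual_tens X Y : hom (Y^* \ox X^* ) (X \ox Y)^* :=
  transpose (ev d Y \oc (idm Y^* \om (lunit Y \oc (ev d X \om idm Y)
    \oc assocV X^* X Y)) \oc assoc Y^* X^* (X \ox Y)).

(* In pivot_tens, monoidality of X |-> X^** relative to the canonical          *)
(* isomorphism of X^** (x) Y^** with (X (x) Y)^** is compared in              *)
(* (Y^* (x) X^* )^*, so that dual_tens need not be inverted. Compatibility    *)
(* with the unit constraints is automatic for isomorphisms.                   *)
Record pivotal (a : forall X, hom X X^*^*) : Prop := Pivotal {
  pivot_iso : forall X, is_iso (a X);
  pivot_natural : forall X Y (f : hom X Y),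
    a Y \oc f = dual_mor (dual_mor f) \oc a X;
  pivot_tens : forall X Y,
    dual_mor (dual_tens X Y) \oc a (X \ox Y) =
    dual_tens Y^* X^* \oc (a X \om a Y) }.

Definition pivotal_dim (a : forall X, hom X X^*^*) X :
    hom (unit_obj : C) unit_obj :=
  ev d X^* \oc (a X \om idm X^* ) \oc coev d X.

End Spherical.

Record sphericalStructure (K : fieldType) (C : monoidalCategory K) :=
  SphericalStructure {
    sph_dual : leftDuals C;
    pivot : forall X, hom X (dual sph_dual (dual sph_dual X));
    pivotP : pivotal pivot;
    sphericalP : forall X,
      pivotal_dim pivot X = pivotal_dim pivot (dual sph_dual X) }.

Record premodularCategory (K : fieldType) := PremodularCategory {
  pm_braided :> braidedCategory K;
  pm_fusion : fusion_category pm_braided;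
  pm_spherical : sphericalStructure pm_braided }.

(* A full subcategory is given by its set of objects. The clause on direct    *)
(* sums is an equivalence: it expresses closure under finite direct sums and  *)
(* direct summands, hence also under isomorphism.                             *)
Record fusion_subcategory (K : fieldType) (C : monoidalCategory K)
    (P : set C) : Prop := FusionSubcategory {
  subcat_unit : P unit_obj;
  subcat_tens : forall X Y, P X -> P Y -> P (X \ox Y);
  subcat_sum : forall n (s : 'I_n -> C) X, direct_sum s X ->
    (P X <-> forall i, P (s i));
  subcat_ldual : forall X Y, left_dual X Y -> P X -> P Y;
  subcat_rdual : forall X Y, left_dual Y X -> P X -> P Y }.

Section FullLinear.
Variables (K : fieldType) (C : linearCategory K) (P : set C).
Local Notation sub := {X : C | P X}.

Definition full_linear : linearCategory K :=
  @LinearCategory K sub (fun X Y => hom (sval X) (sval Y))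
    (fun X => idm (sval X)) (fun _ _ _ g f => g \oc f)
    (fun _ _ _ f => comp_linear_l f) (fun _ _ _ g => comp_linear_r g)
    (fun _ _ _ _ h g f => comp_assoc h g f)
    (fun _ _ f => comp_idl f) (fun _ _ f => comp_idr f).

End FullLinear.

Section FullBraided.
Variables (K : fieldType) (C : braidedCategory K) (P : set C).
Hypothesis fP : fusion_subcategory P.
Local Notation sub := (full_linear P).

Let sub_tens (X Y : sub) : sub :=
  exist _ (sval X \ox sval Y) (subcat_tens fP (svalP X) (svalP Y)).

Definition full_monoidal : monoidalCategory K :=
  @MonoidalCategory K sub (exist _ unit_obj (subcat_unit fP)) sub_tens
    (fun _ _ _ _ f g => f \om g)
    (fun _ _ _ _ g => tensm_linear_l g)
    (fun _ _ _ _ f => tensm_linear_r f)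
    (fun _ _ => tensm_id _ _)
    (fun _ _ _ _ _ _ f' f g' g => tensm_comp f' f g' g)
    (fun _ _ _ => assoc _ _ _) (fun _ _ _ => assocV _ _ _)
    (fun _ => lunit _) (fun _ => lunitV _)
    (fun _ => runit _) (fun _ => runitV _)
    (fun _ _ _ => assocK _ _ _) (fun _ => lunitK _) (fun _ => runitK _)
    (fun _ _ _ _ _ _ f g h => assoc_natural f g h)
    (fun _ _ f => lunit_natural f) (fun _ _ f => runit_natural f)
    (fun _ _ _ _ => pentagon _ _ _ _) (fun _ _ => triangle _ _).

Definition full_braided : braidedCategory K :=
  @BraidedCategory K full_monoidal
    (fun X Y => braid (sval X) (sval Y)) (fun X Y => braid_iso _ _)
    (fun _ _ _ _ f g => braid_natural f g)
    (fun _ _ _ => hexagon_l _ _ _) (fun _ _ _ => hexagon_r _ _ _).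

End FullBraided.

Definition maximal_fusion_subcategory (K : fieldType)
    (C : monoidalCategory K) (P : set C) : Prop :=
  [/\ fusion_subcategory P, P `<` [set: C]
    & (rank (full_linear P) + 1 = rank C)%N].

Definition symmetric_center (K : fieldType) (C : braidedCategory K) : set C :=
  [set X | forall Y, braid Y X \oc braid X Y = idm (X \ox Y)].

Arguments symmetric_center {K} C.

Record linearFunctor (K : fieldType) (C D : linearCategory K) :=
  LinearFunctor {
    fobj :> C -> D;
    fmor : forall X Y, hom X Y -> hom (fobj X) (fobj Y);
    fmor_linear : forall X Y, linear (@fmor X Y);
    fmor_id : forall X, fmor (idm X) = idm (fobj X);
    fmor_comp : forall X Y Z (g : hom Y Z) (f : hom X Y),
      fmor (g \oc f) = fmor g \oc fmor f }.

Arguments fmor {K C D} F {X Y} f : rename.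

Definition equivalence (K : fieldType) (C D : linearCategory K)
    (F : linearFunctor C D) : Prop :=
  exists (G : linearFunctor D C)
    (eta : forall X, hom X (G (F X))) (eps : forall Y, hom (F (G Y)) Y),
    [/\ forall X, is_iso (eta X), forall Y, is_iso (eps Y),
        forall X X' (f : hom X X'),
          eta X' \oc f = fmor G (fmor F f) \oc eta X
      & forall Y Y' (g : hom Y Y'),
          eps Y' \oc fmor F (fmor G g) = g \oc eps Y].

Record braidedStructure (K : fieldType) (C D : braidedCategory K)
    (F : linearFunctor C D) := BraidedStructure {
  fmu : forall X Y, hom (F X \ox F Y) (F (X \ox Y));
  feps : hom unit_obj (F unit_obj);
  fmu_iso : forall X Y, is_iso (fmu X Y);
  feps_iso : is_iso feps;
  fmu_natural : forall X X' Y Y' (f : hom X X') (g : hom Y Y'),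
    fmu X' Y' \oc (fmor F f \om fmor F g) = fmor F (f \om g) \oc fmu X Y;
  fmu_assoc : forall X Y Z,
    fmor F (assoc X Y Z) \oc fmu (X \ox Y) Z \oc (fmu X Y \om idm (F Z)) =
    fmu X (Y \ox Z) \oc (idm (F X) \om fmu Y Z) \oc assoc (F X) (F Y) (F Z);
  fmu_lunit : forall X,
    fmor F (lunit X) \oc fmu unit_obj X \oc (feps \om idm (F X)) =
    lunit (F X);
  fmu_runit : forall X,
    fmor F (runit X) \oc fmu X unit_obj \oc (idm (F X) \om feps) =
    runit (F X);
  fmu_braid : forall X Y,
    fmor F (braid X Y) \oc fmu X Y = fmu Y X \oc braid (F X) (F Y) }.

Definition braided_equivalent (K : fieldType) (C D : braidedCategory K) :=
  exists F : linearFunctor C D, equivalence F /\ inhabited (braidedStructure F).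

(* Matrices act on row vectors, as everywhere in MathComp: a morphism V -> W  *)
(* is a matrix A with rho_V g *m A = A *m rho_W g, and composition g \oc f is *)
(* the matrix product f *m g. Tensor products are Kronecker products, indexed *)
(* through mxtens_index : 'I_m * 'I_n -> 'I_(m * n).                          *)
Section Rep.
Variables (K : fieldType) (gT : finGroupType).
Local Notation repr := (mx_representation K [set: gT]%G).

Record rep := MkRep { rep_dim : nat; rep_mx :> repr rep_dim }.

Implicit Types U V W : rep.

Definition defect V W (A : 'M[K]_(rep_dim V, rep_dim W)) :
    {ffun gT -> 'M[K]_(rep_dim V, rep_dim W)} :=
  [ffun g => V g *m A - A *m W g].

Lemma defect_linear V W : linear (@defect V W).
Proof.
move=> a A B; apply/ffunP => g; rewrite !ffunE.
by rewrite mulmxDr mulmxDl -scalemxAr -scalemxAl scalerBr opprD addrACA.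
Qed.

HB.instance Definition _ V W :=
  GRing.isLinear.Build K _ _ _ (@defect V W) (@defect_linear V W).

Definition intertwiners V W : {vspace 'M[K]_(rep_dim V, rep_dim W)} :=
  lker (linfun (@defect V W)).

Lemma intertwinersP V W A :
  reflect (forall g, V g *m A = A *m W g) (A \in intertwiners V W).
Proof.
rewrite memv_ker lfunE; apply: (iffP eqP) => [/ffunP h g | h].
  by move/eqP: (h g); rewrite !ffunE subr_eq0 => /eqP.
by apply/ffunP => g; rewrite !ffunE h subrr.
Qed.

Definition rep_hom V W : vectType K := subvs_of (intertwiners V W).

Definition mk_hom V W A (h : forall g, V g *m A = A *m W g) : rep_hom V W :=
  Subvs (introT (@intertwinersP V W A) h).

Lemma rep_homP V W (f : rep_hom V W) g : V g *m vsval f = vsval f *m W g.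
Proof. by apply/intertwinersP; apply: subvsP. Qed.

Lemma rep_hom_eq V W (f g : rep_hom V W) : vsval f = vsval g -> f = g.
Proof. exact: val_inj. Qed.

Lemma rep_id_proof V g : V g *m 1%:M = 1%:M *m V g.
Proof. by rewrite mulmx1 mul1mx. Qed.

Lemma rep_comp_proof U V W (f : rep_hom V W) (e : rep_hom U V) g :
  U g *m (vsval e *m vsval f) = (vsval e *m vsval f) *m W g.
Proof. by rewrite mulmxA rep_homP -!mulmxA rep_homP. Qed.

Definition rep_id V : rep_hom V V := mk_hom (@rep_id_proof V).

Definition rep_comp U V W (f : rep_hom V W) (e : rep_hom U V) : rep_hom U W :=
  mk_hom (rep_comp_proof f e).

Lemma rep_comp_linear_l U V W (e : rep_hom U V) :
  linear (fun f : rep_hom V W => rep_comp f e).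
Proof. by move=> a f f'; apply: rep_hom_eq; rewrite /= !linearP. Qed.

Lemma rep_comp_linear_r U V W (f : rep_hom V W) :
  linear (fun e : rep_hom U V => rep_comp f e).
Proof.
by move=> a e e'; apply: rep_hom_eq; rewrite /= mulmxDl -scalemxAl.
Qed.

Lemma rep_compA U V W X (h : rep_hom W X) (g : rep_hom V W) (f : rep_hom U V) :
  rep_comp h (rep_comp g f) = rep_comp (rep_comp h g) f.
Proof. by apply: rep_hom_eq; rewrite /= mulmxA. Qed.

Lemma rep_comp_idl V W (f : rep_hom V W) : rep_comp (rep_id W) f = f.
Proof. by apply: rep_hom_eq; rewrite /= mulmx1. Qed.

Lemma rep_comp_idr V W (f : rep_hom V W) : rep_comp f (rep_id V) = f.
Proof. by apply: rep_hom_eq; rewrite /= mul1mx. Qed.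

Definition rep_linear : linearCategory K :=
  LinearCategory rep_comp_linear_l rep_comp_linear_r rep_compA
    rep_comp_idl rep_comp_idr.

Lemma triv_mx_repr : mx_repr [set: gT]%G (fun=> 1%:M : 'M[K]_1).
Proof. by split=> // g h _ _; rewrite mulmx1. Qed.

Definition rep_unit : rep := MkRep (MxRepresentation triv_mx_repr).

Lemma tensmx1 m n : (1%:M : 'M[K]_m) *t (1%:M : 'M[K]_n) = 1%:M.
Proof.
apply/matrixP => i j.
case: (mxtens_indexP i) => i1 i2; case: (mxtens_indexP j) => j1 j2.
by rewrite tensmxE !mxE (can_eq (@mxtens_indexK m n)) -natrM mulnb.
Qed.

Lemma tens_mx_repr V W : mx_repr [set: gT]%G (fun g => V g *t W g).
Proof.
by split=> [|g h gG hG]; rewrite ?repr_mx1 ?tensmx1 // !repr_mxM // tensmx_mul.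
Qed.

Definition rep_tens V W : rep := MkRep (MxRepresentation (tens_mx_repr V W)).

Lemma rep_tensm_proof V V' W W' (f : rep_hom V V') (h : rep_hom W W') g :
  rep_tens V W g *m (vsval f *t vsval h) =
  (vsval f *t vsval h) *m rep_tens V' W' g.
Proof. by rewrite /= !tensmx_mul !rep_homP. Qed.

Definition rep_tensm V V' W W' (f : rep_hom V V') (h : rep_hom W W') :
    rep_hom (rep_tens V W) (rep_tens V' W') :=
  mk_hom (V := rep_tens V W) (W := rep_tens V' W') (rep_tensm_proof f h).

Lemma rep_tensm_linear_l V V' W W' (h : rep_hom W W') :
  linear (fun f : rep_hom V V' => rep_tensm f h).
Proof.
move=> a f f'; apply: rep_hom_eq; apply/matrixP => i j.
by rewrite /= !mxE mulrDl mulrA.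
Qed.

Lemma rep_tensm_linear_r V V' W W' (f : rep_hom V V') :
  linear (fun h : rep_hom W W' => rep_tensm f h).
Proof.
move=> a h h'; apply: rep_hom_eq; apply/matrixP => i j.
by rewrite /= !mxE mulrDr mulrCA.
Qed.

Lemma rep_tensm_id V W : rep_tensm (rep_id V) (rep_id W) = rep_id (rep_tens V W).
Proof. by apply: rep_hom_eq; rewrite /= tensmx1. Qed.

Lemma rep_tensm_comp V V' V'' W W' W'' (f' : rep_hom V' V'') (f : rep_hom V V')
    (h' : rep_hom W' W'') (h : rep_hom W W') :
  rep_tensm (rep_comp f' f) (rep_comp h' h) =
  rep_comp (rep_tensm f' h') (rep_tensm f h).
Proof. by apply: rep_hom_eq; rewrite /= tensmx_mul. Qed.

(* The structural isomorphisms all permute the canonical bases:               *)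
(* reidx f maps e_i to e_(f i).                                               *)
Definition reidx m n (f : 'I_m -> 'I_n) : 'M[K]_(m, n) := rowsub f 1%:M.

Lemma reidx_comp m n p (f : 'I_m -> 'I_n) (h : 'I_n -> 'I_p) :
  reidx f *m reidx h = reidx (h \o f).
Proof. by rewrite /reidx -rowsubE -rowsub_comp. Qed.

Lemma reidx_id m (f : 'I_m -> 'I_m) : f =1 id -> reidx f = 1%:M.
Proof. by move=> h; apply/matrixP => i j; rewrite !mxE h. Qed.

Lemma eq_reidx m n (f h : 'I_m -> 'I_n) : f =1 h -> reidx f = reidx h.
Proof. by move=> h'; apply/matrixP => i j; rewrite !mxE h'. Qed.

Lemma reidx_natural m n m' n' (f : 'I_m -> 'I_m') (f' : 'I_n -> 'I_n')
    (fV : 'I_n' -> 'I_n) (A : 'M[K]_(m, n)) (B : 'M[K]_(m', n')) :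
    cancel f' fV -> cancel fV f' -> (forall i j, A i j = B (f i) (f' j)) ->
  A *m reidx f' = reidx f *m B.
Proof.
move=> fK fVK AB; rewrite /reidx -rowsubE; apply/matrixP => i j.
rewrite !mxE (bigD1 (fV j)) //= !mxE fVK eqxx mulr1 big1 ?addr0.
  by rewrite AB fVK.
by move=> k; rewrite !mxE -(can2_eq fK fVK) => /negPf ->; rewrite mulr0.
Qed.


Definition idx_assoc m n p (k : 'I_(m * n * p)) : 'I_(m * (n * p)) :=
  let: (ij, l) := mxtens_unindex k in
  let: (i, j) := mxtens_unindex ij in mxtens_index (i, mxtens_index (j, l)).

Definition idx_assocV m n p (k : 'I_(m * (n * p))) : 'I_(m * n * p) :=
  let: (i, jl) := mxtens_unindex k in
  let: (j, l) := mxtens_unindex jl in mxtens_index (mxtens_index (i, j), l).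

Definition idx_lunit n (k : 'I_(1 * n)) : 'I_n := (mxtens_unindex k).2.
Definition idx_lunitV n (i : 'I_n) : 'I_(1 * n) := mxtens_index (ord0, i).
Definition idx_runit n (k : 'I_(n * 1)) : 'I_n := (mxtens_unindex k).1.
Definition idx_runitV n (i : 'I_n) : 'I_(n * 1) := mxtens_index (i, ord0).

Definition idx_swap m n (k : 'I_(m * n)) : 'I_(n * m) :=
  let: (i, j) := mxtens_unindex k in mxtens_index (j, i).

Definition idx_map m n p q (f : 'I_m -> 'I_n) (h : 'I_p -> 'I_q)
    (k : 'I_(m * p)) : 'I_(n * q) :=
  let: (i, j) := mxtens_unindex k in mxtens_index (f i, h j).

Lemma idx_assocE m n p (i : 'I_m) (j : 'I_n) (l : 'I_p) :
  idx_assoc (mxtens_index (mxtens_index (i, j), l)) =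
  mxtens_index (i, mxtens_index (j, l)).
Proof. by rewrite /idx_assoc !mxtens_indexK. Qed.

Lemma idx_assocVE m n p (i : 'I_m) (j : 'I_n) (l : 'I_p) :
  idx_assocV (mxtens_index (i, mxtens_index (j, l))) =
  mxtens_index (mxtens_index (i, j), l).
Proof. by rewrite /idx_assocV !mxtens_indexK. Qed.

Lemma idx_lunitE n (i : 'I_1) (j : 'I_n) : idx_lunit (mxtens_index (i, j)) = j.
Proof. by rewrite /idx_lunit mxtens_indexK. Qed.

Lemma idx_runitE n (i : 'I_n) (j : 'I_1) : idx_runit (mxtens_index (i, j)) = i.
Proof. by rewrite /idx_runit mxtens_indexK. Qed.

Lemma idx_swapE m n (i : 'I_m) (j : 'I_n) :
  idx_swap (mxtens_index (i, j)) = mxtens_index (j, i).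
Proof. by rewrite /idx_swap mxtens_indexK. Qed.

Lemma idx_mapE m n p q (f : 'I_m -> 'I_n) (h : 'I_p -> 'I_q) i j :
  idx_map f h (mxtens_index (i, j)) = mxtens_index (f i, h j).
Proof. by rewrite /idx_map mxtens_indexK. Qed.

Definition idxE := (idx_assocE, idx_assocVE, idx_lunitE, idx_runitE, idx_swapE,
  idx_mapE).

Lemma idx_assocK m n p : cancel (@idx_assoc m n p) (@idx_assocV m n p).
Proof.
by move=> k; case: (mxtens_indexP k) => ij l; case: (mxtens_indexP ij) => i j;
  rewrite !idxE.
Qed.

Lemma idx_assocVK m n p : cancel (@idx_assocV m n p) (@idx_assoc m n p).
Proof.
by move=> k; case: (mxtens_indexP k) => i jl; case: (mxtens_indexP jl) => j l;
  rewrite !idxE.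
Qed.

Lemma idx_lunitK n : cancel (@idx_lunit n) (@idx_lunitV n).
Proof. by move=> k; case: (mxtens_indexP k) => i j; rewrite !idxE (ord1 i). Qed.

Lemma idx_lunitVK n : cancel (@idx_lunitV n) (@idx_lunit n).
Proof. by move=> k; rewrite !idxE. Qed.

Lemma idx_runitK n : cancel (@idx_runit n) (@idx_runitV n).
Proof. by move=> k; case: (mxtens_indexP k) => i j; rewrite !idxE (ord1 j). Qed.

Lemma idx_runitVK n : cancel (@idx_runitV n) (@idx_runit n).
Proof. by move=> k; rewrite !idxE. Qed.

Lemma idx_swapK m n : cancel (@idx_swap m n) (@idx_swap n m).
Proof. by move=> k; case: (mxtens_indexP k) => i j; rewrite !idxE. Qed.

Lemma assoc_mx m m' n n' p p' (A : 'M[K]_(m, m')) (B : 'M[K]_(n, n'))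
    (D : 'M[K]_(p, p')) :
  ((A *t B) *t D) *m reidx (@idx_assoc m' n' p') =
  reidx (@idx_assoc m n p) *m (A *t (B *t D)).
Proof.
apply: (reidx_natural (@idx_assocK _ _ _) (@idx_assocVK _ _ _)) => k k'.
case: (mxtens_indexP k) => ij l; case: (mxtens_indexP ij) => i j.
case: (mxtens_indexP k') => ij' l'; case: (mxtens_indexP ij') => i' j'.
by rewrite !idxE !tensmxE mulrA.
Qed.

Lemma assocV_mx m m' n n' p p' (A : 'M[K]_(m, m')) (B : 'M[K]_(n, n'))
    (D : 'M[K]_(p, p')) :
  (A *t (B *t D)) *m reidx (@idx_assocV m' n' p') =
  reidx (@idx_assocV m n p) *m ((A *t B) *t D).
Proof.
apply: (reidx_natural (@idx_assocVK _ _ _) (@idx_assocK _ _ _)) => k k'.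
case: (mxtens_indexP k) => i jl; case: (mxtens_indexP jl) => j l.
case: (mxtens_indexP k') => i' jl'; case: (mxtens_indexP jl') => j' l'.
by rewrite !idxE !tensmxE mulrA.
Qed.

Lemma lunit_mx m n (A : 'M[K]_(m, n)) :
  (1%:M *t A) *m reidx (@idx_lunit n) = reidx (@idx_lunit m) *m A.
Proof.
apply: (reidx_natural (@idx_lunitK _) (@idx_lunitVK _)) => k k'.
case: (mxtens_indexP k) => i j; case: (mxtens_indexP k') => i' j'.
by rewrite !idxE !tensmxE (ord1 i) (ord1 i') mxE mul1r.
Qed.

Lemma lunitV_mx m n (A : 'M[K]_(m, n)) :
  A *m reidx (@idx_lunitV n) = reidx (@idx_lunitV m) *m (1%:M *t A).
Proof.
apply: (reidx_natural (@idx_lunitVK _) (@idx_lunitK _)) => k k'.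
by rewrite !tensmxE mxE mul1r.
Qed.

Lemma runit_mx m n (A : 'M[K]_(m, n)) :
  (A *t 1%:M) *m reidx (@idx_runit n) = reidx (@idx_runit m) *m A.
Proof.
apply: (reidx_natural (@idx_runitK _) (@idx_runitVK _)) => k k'.
case: (mxtens_indexP k) => i j; case: (mxtens_indexP k') => i' j'.
by rewrite !idxE !tensmxE (ord1 j) (ord1 j') mxE mulr1.
Qed.

Lemma runitV_mx m n (A : 'M[K]_(m, n)) :
  A *m reidx (@idx_runitV n) = reidx (@idx_runitV m) *m (A *t 1%:M).
Proof.
apply: (reidx_natural (@idx_runitVK _) (@idx_runitK _)) => k k'.
by rewrite !tensmxE mxE mulr1.
Qed.

Lemma swap_mx m m' n n' (A : 'M[K]_(m, m')) (B : 'M[K]_(n, n')) :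
  (A *t B) *m reidx (@idx_swap m' n') = reidx (@idx_swap m n) *m (B *t A).
Proof.
apply: (reidx_natural (@idx_swapK _ _) (@idx_swapK _ _)) => k k'.
case: (mxtens_indexP k) => i j; case: (mxtens_indexP k') => i' j'.
by rewrite !idxE !tensmxE mulrC.
Qed.

Definition rep_assoc U V W :
    rep_hom (rep_tens (rep_tens U V) W) (rep_tens U (rep_tens V W)) :=
  mk_hom (V := rep_tens (rep_tens U V) W) (W := rep_tens U (rep_tens V W))
    (fun g => assoc_mx (U g) (V g) (W g)).

Definition rep_assocV U V W :
    rep_hom (rep_tens U (rep_tens V W)) (rep_tens (rep_tens U V) W) :=
  mk_hom (V := rep_tens U (rep_tens V W)) (W := rep_tens (rep_tens U V) W)
    (fun g => assocV_mx (U g) (V g) (W g)).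

Definition rep_lunit V : rep_hom (rep_tens rep_unit V) V :=
  mk_hom (V := rep_tens rep_unit V) (fun g => lunit_mx (V g)).

Definition rep_lunitV V : rep_hom V (rep_tens rep_unit V) :=
  mk_hom (W := rep_tens rep_unit V) (fun g => lunitV_mx (V g)).

Definition rep_runit V : rep_hom (rep_tens V rep_unit) V :=
  mk_hom (V := rep_tens V rep_unit) (fun g => runit_mx (V g)).

Definition rep_runitV V : rep_hom V (rep_tens V rep_unit) :=
  mk_hom (W := rep_tens V rep_unit) (fun g => runitV_mx (V g)).

Definition rep_braid V W : rep_hom (rep_tens V W) (rep_tens W V) :=
  mk_hom (V := rep_tens V W) (W := rep_tens W V)
    (fun g => swap_mx (V g) (W g)).

Lemma rep_inverse_pair V W (f : rep_hom V W) (h : rep_hom W V) u v :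
    vsval f = reidx u -> vsval h = reidx v -> cancel u v -> cancel v u ->
  @inverse_pair K rep_linear V W f h.
Proof.
by move=> fE hE uK vK; split; apply: rep_hom_eq;
  rewrite /= fE hE reidx_comp reidx_id.
Qed.

Lemma tens_reidx m n p q (f : 'I_m -> 'I_n) (h : 'I_p -> 'I_q) :
  reidx f *t reidx h = reidx (idx_map f h).
Proof.
apply/matrixP => k k'; case: (mxtens_indexP k) => i j.
case: (mxtens_indexP k') => i' j'.
rewrite tensmxE /reidx ![rowsub _ _ _ _]mxE idxE !mxE.
by rewrite (can_eq (@mxtens_indexK _ _)) -natrM mulnb.
Qed.

Lemma tens_reidxl m n p (f : 'I_m -> 'I_n) :
  reidx f *t (1%:M : 'M[K]_p) = reidx (idx_map f id).
Proof. by rewrite -tens_reidx (@reidx_id p id). Qed.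

Lemma tens_reidxr m n p (f : 'I_m -> 'I_n) :
  (1%:M : 'M[K]_p) *t reidx f = reidx (idx_map id f).
Proof. by rewrite -tens_reidx (@reidx_id p id). Qed.

Lemma rep_pentagon (X Y Z W : rep) :
  rep_comp (rep_assoc X Y (rep_tens Z W)) (rep_assoc (rep_tens X Y) Z W) =
  rep_comp (rep_comp (rep_tensm (rep_id X) (rep_assoc Y Z W))
                     (rep_assoc X (rep_tens Y Z) W))
           (rep_tensm (rep_assoc X Y Z) (rep_id W)).
Proof.
apply: rep_hom_eq; rewrite /= tens_reidxl tens_reidxr !reidx_comp.
apply: eq_reidx => k /=.
case: (mxtens_indexP k) => k' l; case: (mxtens_indexP k') => k'' j.
case: (mxtens_indexP k'') => h i.
by rewrite !idxE.
Qed.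

Lemma rep_triangle (X Y : rep) :
  rep_comp (rep_tensm (rep_id X) (rep_lunit Y)) (rep_assoc X rep_unit Y) =
  rep_tensm (rep_runit X) (rep_id Y).
Proof.
apply: rep_hom_eq; rewrite /= tens_reidxl tens_reidxr !reidx_comp.
apply: eq_reidx => k /=.
case: (mxtens_indexP k) => k' l; case: (mxtens_indexP k') => h i.
by rewrite !idxE.
Qed.

Definition rep_monoidal : monoidalCategory K.
Proof.
refine (@MonoidalCategory K rep_linear rep_unit rep_tens rep_tensm
  rep_tensm_linear_l rep_tensm_linear_r rep_tensm_id rep_tensm_comp
  rep_assoc rep_assocV rep_lunit rep_lunitV rep_runit rep_runitV
  _ _ _ _ _ _ rep_pentagon rep_triangle).
- move=> X Y Z; apply: (@rep_inverse_pair _ _ (rep_assoc X Y Z) (rep_assocV X Y Z)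
    (@idx_assoc _ _ _) (@idx_assocV _ _ _)) => //.
    exact: idx_assocK.
  exact: idx_assocVK.
- move=> X; apply: (@rep_inverse_pair _ _ (rep_lunit X) (rep_lunitV X)
    (@idx_lunit _) (@idx_lunitV _)) => //.
    exact: idx_lunitK.
  exact: idx_lunitVK.
- move=> X; apply: (@rep_inverse_pair _ _ (rep_runit X) (rep_runitV X)
    (@idx_runit _) (@idx_runitV _)) => //.
    exact: idx_runitK.
  exact: idx_runitVK.
- by move=> X X' Y Y' Z Z' f g h; apply: rep_hom_eq; exact: assoc_mx.
- by move=> X Y f; apply: rep_hom_eq; exact: lunit_mx.
- by move=> X Y f; apply: rep_hom_eq; exact: runit_mx.
Defined.

Definition rep_braided : braidedCategory K.
Proof.
refine (@BraidedCategory K rep_monoidal rep_braid _ _ _ _).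
- move=> X Y; exists (rep_braid Y X).
  by apply: (@rep_inverse_pair _ _ (rep_braid X Y) (rep_braid Y X)
    (@idx_swap _ _) (@idx_swap _ _)) => //; exact: idx_swapK.
- by move=> X X' Y Y' f g; apply: rep_hom_eq; exact: swap_mx.
- move=> X Y Z; apply: rep_hom_eq.
  rewrite /= tens_reidxl tens_reidxr !reidx_comp; apply: eq_reidx => k /=.
  case: (mxtens_indexP k) => k' l; case: (mxtens_indexP k') => i j.
  by rewrite !idxE.
- move=> X Y Z; apply: rep_hom_eq.
  rewrite /= tens_reidxl tens_reidxr !reidx_comp; apply: eq_reidx => k /=.
  case: (mxtens_indexP k) => i k'; case: (mxtens_indexP k') => j l.
  by rewrite !idxE.
Defined.

End Rep.

Definition tannakian (K : fieldType) (C : braidedCategory K) (P : set C) :=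
  exists (fP : fusion_subcategory P) (gT : finGroupType),
    braided_equivalent (full_braided fP) (rep_braided K gT).

(* Main.v *)
Require Import Defs.
From mathcomp Require Import all_boot all_order all_algebra.
From mathcomp Require Import complex.
From mathcomp Require Import boolp classical_sets reals.
(* Defs again, because vector.v shadows its [hom]. *)
Require Import Defs.

(* Write Z for the symmetric center and D' for the centralizer of D; D' is a  *)
(* fusion subcategory containing Z and, since D is symmetric, also D. If Z is *)
(* not contained in D, it contains one of the two simple objects X, Y outside *)
(* D, say X. The point is that then D lies in Z. If Y is in D', then D' is    *)
(* all of C. Otherwise, for V in D, the simple summands of X (x) V are in D', *)
(* hence different from Y, and not in D, since X is not; so they are all      *)
(* isomorphic to X. Thus X (x) V is in Z, and so is its image under           *)
(* X^* (x) -, of which V is a retract. Now Z contains all simple objects      *)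
(* except possibly Y.                                                         *)

Set Implicit Arguments.
Unset Strict Implicit.
Unset Printing Implicit Defensive.

Import GRing.Theory.
Local Open Scope ring_scope.
Local Open Scope classical_set_scope.
Local Open Scope cat_scope.

Section UnbundledLinear.
Variables (K : fieldType) (U V : lmodType K) (f : U -> V).
Hypothesis f_lin : linear f.

Lemma linear_map0 : f 0 = 0.
Proof. by have := f_lin (-1) 0 0; rewrite scaler0 addr0 scaleN1r addNr. Qed.

Lemma linear_mapB u v : f (u - v) = f u - f v.
Proof. by rewrite addrC -scaleN1r f_lin scaleN1r addrC. Qed.

Lemma linear_map_sum n (u : 'I_n -> U) : f (\sum_i u i) = \sum_i f (u i).
Proof.
apply: (big_morph f) => [x y|]; last exact: linear_map0.
by rewrite -[x]scale1r f_lin !scale1r.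
Qed.

End UnbundledLinear.

Section LinearCategory.
Variables (K : fieldType) (C : linearCategory K).
Implicit Types X Y Z : C.

Lemma comp0l X Y Z (f : hom X Y) : (0 : hom Y Z) \oc f = 0.
Proof. exact: (linear_map0 (comp_linear_l f)). Qed.

Lemma comp0r X Y Z (g : hom Y Z) : g \oc (0 : hom X Y) = 0.
Proof. exact: (linear_map0 (comp_linear_r g)). Qed.

Lemma compBr X Y Z (f g : hom X Y) (h : hom Y Z) :
  h \oc (f - g) = (h \oc f) - (h \oc g).
Proof. exact: (linear_mapB (comp_linear_r h)). Qed.

Lemma comp_sumr X Y Z n (f : 'I_n -> hom X Y) (g : hom Y Z) :
  g \oc (\sum_i f i) = \sum_i (g \oc f i).
Proof. exact: (linear_map_sum (comp_linear_r g)). Qed.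

Lemma iso_mono X Y (f : hom X Y) : is_iso f -> mono f.
Proof.
case=> g [gf _] W u v fu.
by rewrite -(comp_idl u) -(comp_idl v) -gf -!comp_assoc fu.
Qed.

Lemma iso_epi X Y (f : hom X Y) : is_iso f -> epi f.
Proof.
case=> g [_ fg] W u v uf.
by rewrite -(comp_idr u) -(comp_idr v) -fg !comp_assoc uf.
Qed.

Lemma is_iso_id X : is_iso (idm X).
Proof. by exists (idm X); split; rewrite comp_idl. Qed.

Lemma is_iso_comp X Y Z (g : hom Y Z) (f : hom X Y) :
  is_iso g -> is_iso f -> is_iso (g \oc f).
Proof.
move=> [g' [g'g gg']] [f' [f'f ff']]; exists (f' \oc g'); split.
  by rewrite -comp_assoc (comp_assoc g') g'g comp_idl.
by rewrite -comp_assoc (comp_assoc f) ff' comp_idl.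
Qed.

Lemma inverse_pairC X Y (f : hom X Y) (g : hom Y X) :
  inverse_pair f g -> inverse_pair g f.
Proof. by case. Qed.

Lemma inverse_pair_iso X Y (f : hom X Y) (g : hom Y X) :
  inverse_pair f g -> is_iso f.
Proof. by exists g. Qed.

Lemma iso_left_inverse X Y (f : hom X Y) (g : hom Y X) :
  is_iso f -> g \oc f = idm X -> f \oc g = idm Y.
Proof.
move=> f_iso gf; apply: (iso_epi f_iso).
by rewrite -comp_assoc gf comp_idr comp_idl.
Qed.

Lemma isomorphic_sym X Y : isomorphic X Y -> isomorphic Y X.
Proof. by case=> f [g fg]; exists g, f; apply: inverse_pairC. Qed.

Lemma isomorphic_trans X Y Z :
  isomorphic X Y -> isomorphic Y Z -> isomorphic X Z.
Proof.
by move=> [f fi] [g gi]; exists (g \oc f); apply: is_iso_comp.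
Qed.

Lemma is_zeroE X : is_zero X <-> idm X = 0.
Proof.
split=> [/(_ X) [h _] //|id0 Y]; split=> f.
  by rewrite -(comp_idr f) id0 comp0r.
by rewrite -(comp_idl f) id0 comp0l.
Qed.

Lemma is_zero_iso X Y : isomorphic X Y -> is_zero X -> is_zero Y.
Proof.
move=> [f [g [_ fg]]] X0; apply/is_zeroE.
by rewrite -fg (proj1 (X0 Y) f) comp0l.
Qed.

Lemma simple_iso X Y : isomorphic X Y -> simple_obj X -> simple_obj Y.
Proof.
move=> XY [Xn0 Xs]; split=> [Y0|Z f f_mono].
  by apply: Xn0; apply: is_zero_iso Y0; apply: isomorphic_sym.
have [g g_iso] := isomorphic_sym XY.
have [||gf_iso] := Xs _ (g \oc f).
- move=> W u v; rewrite -!comp_assoc => /(iso_mono g_iso); exact: f_mono.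
- by left.
right; have [g' [g'g gg']] := g_iso.
have -> : f = g' \oc (g \oc f) by rewrite comp_assoc g'g comp_idl.
by apply: is_iso_comp => //; exists g.
Qed.

Lemma direct_sum1 X Y : isomorphic X Y -> direct_sum (fun _ : 'I_1 => X) Y.
Proof.
move=> [f [g [gf fg]]]; exists (fun=> f), (fun=> g); split=> //.
  by move=> i j; rewrite !ord1.
by rewrite big_ord1.
Qed.

Lemma split_mono X Y (f : hom X Y) (g : hom Y X) : g \oc f = idm X -> mono f.
Proof.
move=> gf W u v fu.
by rewrite -(comp_idl u) -(comp_idl v) -gf -!comp_assoc fu.
Qed.

Lemma direct_sum_nonzero_to n (s : 'I_n -> C) X Y (f : hom X Y) :
  direct_sum s X -> f <> 0 ->
  exists i (j : hom (s i) X), f \oc j <> 0.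
Proof.
move=> [inj [prj [_ _ sum_id]]] fn0; apply: contrapT => none; apply: fn0.
rewrite -(comp_idr f) -sum_id comp_sumr big1 // => i _.
suff fi0 : f \oc inj i = 0 by rewrite comp_assoc fi0 comp0l.
by apply: contrapT => ?; apply: none; exists i, (inj i).
Qed.

Section Abelian.
Hypothesis C_ab : abelian_category C.

Lemma simple_to_mono X Y (f : hom X Y) : simple_obj X -> f <> 0 -> mono f.
Proof.
move=> [_ Xs] fn0 W u v fuv.
have [N [k [fk kU]]] := kernel_exists C_ab f.
have k_mono : mono k.
  move=> A a b ab; have [|c [_ cU]] := kU _ (k \oc a).
    by rewrite comp_assoc fk comp0l.
  by rewrite -(cU a) // -(cU b).
have [N0|k_iso] := Xs _ _ k_mono.
  have [|w [kw _]] := kU _ (u - v); first by rewrite compBr fuv subrr.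
  by apply/eqP; rewrite -subr_eq0 -kw (proj2 (N0 _) w) comp0r.
by case: fn0; apply: (iso_epi k_iso); rewrite fk comp0l.
Qed.

Lemma schur X Y (f : hom X Y) :
  simple_obj X -> simple_obj Y -> f <> 0 -> is_iso f.
Proof.
move=> Xs [_ Ys] fn0; have f_mono := simple_to_mono Xs fn0.
by case: (Ys _ f f_mono) => // X0; case: Xs.
Qed.

End Abelian.

Lemma num_simple_classes_le n m :
  num_simple_classes C n -> num_simple_classes C m -> (n <= m)%N.
Proof.
move=> [s [s_simple s_inj _]] [t [_ _ t_all]].
have [f fP] := choice (fun i => t_all _ (s_simple i)).
rewrite -(card_ord n) -(card_ord m); apply: (@leq_card _ _ f) => i j fij.
apply: s_inj; apply: isomorphic_trans (fP i) _.
by rewrite fij; apply: isomorphic_sym.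
Qed.

Lemma rank_eq n : num_simple_classes C n -> rank C = n.
Proof.
move=> nP; rewrite /rank; case: xgetP => [m _ mP|/(_ n) //].
by apply/eqP; rewrite eqn_leq !num_simple_classes_le.
Qed.

End LinearCategory.

Section Monoidal.
Variables (K : fieldType) (C : monoidalCategory K).
Implicit Types X Y Z W : C.

Lemma tensm0l X X' Y Y' (g : hom Y Y') : (0 : hom X X') \om g = 0.
Proof. exact: (linear_map0 (tensm_linear_l g)). Qed.

Lemma tensm0r X X' Y Y' (f : hom X X') : f \om (0 : hom Y Y') = 0.
Proof. exact: (linear_map0 (tensm_linear_r f)). Qed.

Lemma tensm_sumr X X' Y Y' n (f : hom X X') (g : 'I_n -> hom Y Y') :
  f \om (\sum_i g i) = \sum_i (f \om g i).
Proof. exact: (linear_map_sum (tensm_linear_r f)). Qed.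

Lemma tensm_compl X Y Y' Y'' (g : hom Y' Y'') (f : hom Y Y') :
  (g \oc f) \om idm X = (g \om idm X) \oc (f \om idm X).
Proof. by rewrite -tensm_comp comp_idl. Qed.

Lemma tensm_compr X Y Y' Y'' (g : hom Y' Y'') (f : hom Y Y') :
  idm X \om (g \oc f) = (idm X \om g) \oc (idm X \om f).
Proof. by rewrite -tensm_comp comp_idl. Qed.

Lemma tensm_swap X X' Y Y' (f : hom X X') (g : hom Y Y') :
  (f \om idm Y') \oc (idm X \om g) = (idm X' \om g) \oc (f \om idm Y).
Proof. by rewrite -!tensm_comp !comp_idl !comp_idr. Qed.

Lemma inverse_pair_tensm X X' Y Y' (f : hom X X') f' (g : hom Y Y') g' :
  inverse_pair f f' -> inverse_pair g g' -> inverse_pair (f \om g) (f' \om g').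
Proof.
move=> [f'f ff'] [g'g gg']; split.
  by rewrite -tensm_comp f'f g'g tensm_id.
by rewrite -tensm_comp ff' gg' tensm_id.
Qed.

Lemma is_iso_tensm X X' Y Y' (f : hom X X') (g : hom Y Y') :
  is_iso f -> is_iso g -> is_iso (f \om g).
Proof.
by move=> [f' fP] [g' gP]; exists (f' \om g'); apply: inverse_pair_tensm.
Qed.

Lemma is_iso_assoc X Y Z : is_iso (assoc X Y Z).
Proof. exact: (inverse_pair_iso (assocK X Y Z)). Qed.

Lemma is_iso_assocV X Y Z : is_iso (assocV X Y Z).
Proof. exact: (inverse_pair_iso (inverse_pairC (assocK X Y Z))). Qed.

Lemma is_iso_lunit X : is_iso (lunit X).
Proof. exact: (inverse_pair_iso (lunitK X)). Qed.

Lemma is_iso_lunitV X : is_iso (lunitV X).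
Proof. exact: (inverse_pair_iso (inverse_pairC (lunitK X))). Qed.

Lemma is_iso_runit X : is_iso (runit X).
Proof. exact: (inverse_pair_iso (runitK X)). Qed.

Lemma is_iso_runitV X : is_iso (runitV X).
Proof. exact: (inverse_pair_iso (inverse_pairC (runitK X))). Qed.

Lemma assocVA X Y Z : assocV X Y Z \oc assoc X Y Z = idm _.
Proof. by case: (assocK X Y Z). Qed.

Lemma assocAV X Y Z : assoc X Y Z \oc assocV X Y Z = idm _.
Proof. by case: (assocK X Y Z). Qed.

Lemma assocV_natural X X' Y Y' Z Z'
    (f : hom X X') (g : hom Y Y') (h : hom Z Z') :
  assocV X' Y' Z' \oc (f \om (g \om h)) = (f \om g) \om h \oc assocV X Y Z.
Proof.
apply: (iso_mono (is_iso_assoc _ _ _)); apply: (iso_epi (is_iso_assoc _ _ _)).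
rewrite comp_assoc assocAV comp_idl -!comp_assoc assocVA comp_idr.
by rewrite assoc_natural.
Qed.

Lemma tensm_idl_faithful X Y (f g : hom X Y) :
  idm unit_obj \om f = idm unit_obj \om g -> f = g.
Proof.
move=> fg; apply: (iso_epi (is_iso_lunit _)).
by rewrite -!lunit_natural fg.
Qed.

Lemma tensm_idr_faithful X Y (f g : hom X Y) :
  f \om idm unit_obj = g \om idm unit_obj -> f = g.
Proof.
move=> fg; apply: (iso_epi (is_iso_runit _)).
by rewrite -!runit_natural fg.
Qed.

Lemma pentagonV X Y Z W :
  assoc X (Y \ox Z) W \oc (assoc X Y Z \om idm W) \oc assocV (X \ox Y) Z W =
  (idm X \om assocV Y Z W) \oc assoc X Y (Z \ox W).
Proof.
apply: (iso_mono (is_iso_tensm (is_iso_id X) (is_iso_assoc Y Z W))).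
rewrite !comp_assoc -pentagon -comp_assoc assocAV comp_idr.
by rewrite -tensm_compr assocAV tensm_id comp_idl.
Qed.

Section Duality.
Variables (X Y : C) (ev : hom (Y \ox X) unit_obj) (coev : hom unit_obj (X \ox Y)).
Hypothesis dualXY : duality ev coev.

Lemma zigzag_ev_iso :
  is_iso ((ev \om idm Y) \oc assocV Y X Y \oc (idm Y \om coev)).
Proof.
have [_ zz] := dualXY.
exists (runitV Y \oc lunit Y).
have [VL LV] := lunitK Y; have [VR RV] := runitK Y.
have e : (ev \om idm Y) \oc assocV Y X Y \oc (idm Y \om coev) = lunitV Y \oc runit Y.
  apply: (iso_mono (is_iso_lunit Y)); apply: (iso_epi (is_iso_runitV Y)).
  by rewrite !comp_assoc zz LV comp_idl RV.
rewrite e; split.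
  by rewrite -comp_assoc (comp_assoc (lunit Y)) LV comp_idl VR.
by rewrite -comp_assoc (comp_assoc (runit Y)) RV comp_idl VL.
Qed.

Lemma zigzag_coev_iso :
  is_iso ((idm X \om ev) \oc assoc X Y X \oc (coev \om idm X)).
Proof.
have [zz _] := dualXY.
exists (lunitV X \oc runit X).
have [VL LV] := lunitK X; have [VR RV] := runitK X.
have e : (idm X \om ev) \oc assoc X Y X \oc (coev \om idm X) = runitV X \oc lunit X.
  apply: (iso_mono (is_iso_runit X)); apply: (iso_epi (is_iso_lunitV X)).
  by rewrite !comp_assoc zz RV comp_idl LV.
rewrite e; split.
  by rewrite -comp_assoc (comp_assoc (runit X)) RV comp_idl VL.
by rewrite -comp_assoc (comp_assoc (lunit X)) LV comp_idl VR.
Qed.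

(* The mate of [g] under [- (x) X -| - (x) Y] determines [g]. *)
Lemma ev_nondegenerate A W (g g' : hom A (W \ox Y)) :
  (idm W \om ev) \oc assoc W Y X \oc (g \om idm X) =
  (idm W \om ev) \oc assoc W Y X \oc (g' \om idm X) -> g = g'.
Proof.
move=> gg'.
pose J := (((idm W \om ev) \oc assoc W Y X) \om idm Y) \oc assocV (W \ox Y) X Y
          \oc (idm (W \ox Y) \om coev).
have JE := erefl J; rewrite {2}/J in JE; clearbody J.
have J_mono : mono J.
  move=> B u v Juv; have /iso_mono := is_iso_comp
    (is_iso_tensm (is_iso_id W) zigzag_ev_iso) (is_iso_assoc W Y unit_obj).
  apply.
  suff -> : idm W \om ((ev \om idm Y) \oc assocV Y X Y \oc (idm Y \om coev))
      \oc assoc W Y unit_obj = assoc W unit_obj Y \oc J.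
    by rewrite -!comp_assoc Juv.
  rewrite JE !tensm_compr tensm_compl !comp_assoc assoc_natural.
  rewrite -!comp_assoc; congr (_ \oc _).
  rewrite -assoc_natural tensm_id !comp_assoc; congr (_ \oc _).
  by rewrite pentagonV.
apply: tensm_idr_faithful; apply: J_mono.
have swap (h : hom A (W \ox Y)) : J \oc (h \om idm unit_obj) =
    (((idm W \om ev) \oc assoc W Y X \oc (h \om idm X)) \om idm Y)
      \oc assocV A X Y \oc (idm A \om coev).
  rewrite JE -[LHS]comp_assoc -tensm_swap (tensm_compl _ _ (h \om idm X)).
  rewrite -!comp_assoc; congr (_ \oc _); rewrite !comp_assoc; congr (_ \oc _).
  by rewrite -assocV_natural tensm_id.
by rewrite !swap gg'.
Qed.

(* The mate of [h] under [- (x) X -| - (x) Y] determines [h]. *)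
Lemma coev_nondegenerate B W (h h' : hom (W \ox X) B) :
  (h \om idm Y) \oc assocV W X Y \oc (idm W \om coev) =
  (h' \om idm Y) \oc assocV W X Y \oc (idm W \om coev) -> h = h'.
Proof.
move=> hh'.
pose J := (idm (W \ox X) \om ev) \oc assoc (W \ox X) Y X
          \oc ((assocV W X Y \oc (idm W \om coev)) \om idm X).
have JE := erefl J; rewrite {2}/J in JE; clearbody J.
have J_epi : epi J.
  move=> D u v Juv; have /iso_epi := is_iso_comp
    (is_iso_tensm (is_iso_id W) zigzag_coev_iso) (is_iso_assoc W unit_obj X).
  suff e : idm W \om ((idm X \om ev) \oc assoc X Y X \oc (coev \om idm X))
      \oc assoc W unit_obj X = assoc W X unit_obj \oc J.
    rewrite e => /(_ D (u \oc assocV W X unit_obj) (v \oc assocV W X unit_obj)) euv.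
    apply: (iso_epi (is_iso_assocV W X unit_obj)); apply: euv.
    by rewrite -!comp_assoc !(comp_assoc (assocV _ _ _)) assocVA comp_idl.
  rewrite JE !tensm_compr tensm_compl !comp_assoc -tensm_id assoc_natural.
  rewrite -!comp_assoc; congr (_ \oc _); rewrite -assoc_natural.
  rewrite (comp_assoc (assoc W X _)) pentagon.
  rewrite -!comp_assoc; congr (_ \oc _); congr (_ \oc _).
  by rewrite comp_assoc -tensm_compl assocAV tensm_id comp_idl.
apply: tensm_idr_faithful; apply: J_epi.
have swap (k : hom (W \ox X) B) : (k \om idm unit_obj) \oc J =
    (idm B \om ev) \oc assoc B Y X
      \oc (((k \om idm Y) \oc assocV W X Y \oc (idm W \om coev)) \om idm X).
  rewrite JE !comp_assoc tensm_swap -(comp_assoc (k \om _)).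
  rewrite (tensm_compl _ (k \om idm Y)) !comp_assoc; congr (_ \oc _).
  rewrite -!comp_assoc; congr (_ \oc _).
  by rewrite assoc_natural tensm_id.
by rewrite !swap hh'.
Qed.

Lemma ev_neq0 : ~ is_zero X -> ev <> 0.
Proof.
move=> Xn0 ev0; apply: Xn0; apply/is_zeroE.
apply: tensm_idl_faithful; apply: (iso_mono zigzag_coev_iso).
by rewrite ev0 tensm0r !comp0l.
Qed.

End Duality.
End Monoidal.

Section Braided.
Variables (K : fieldType) (C : braidedCategory K).
Implicit Types X Y Z W : C.

Definition monodromy X Y : hom (X \ox Y) (X \ox Y) :=
  locked (braid Y X \oc braid X Y).

Lemma monodromyE X Y : monodromy X Y = braid Y X \oc braid X Y.
Proof. by rewrite /monodromy -lock. Qed.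

Lemma monodromyC X Y :
  monodromy X Y = idm (X \ox Y) -> monodromy Y X = idm (Y \ox X).
Proof. rewrite !monodromyE; exact: iso_left_inverse (braid_iso X Y). Qed.

Lemma monodromy_natural X X' Y Y' (f : hom X X') (g : hom Y Y') :
  monodromy X' Y' \oc (f \om g) = (f \om g) \oc monodromy X Y.
Proof.
by rewrite !monodromyE -comp_assoc braid_natural comp_assoc braid_natural comp_assoc.
Qed.

Lemma is_iso_monodromy X Y : is_iso (monodromy X Y).
Proof. by rewrite monodromyE; apply: is_iso_comp; apply: braid_iso. Qed.

Lemma monodromy_tens X Y Z :
  monodromy X (Y \ox Z) =
  assoc X Y Z \oc (braid Y X \om idm Z) \oc assocV Y X Z
    \oc (idm Y \om monodromy X Z)
    \oc assoc Y X Z \oc (braid X Y \om idm Z) \oc assocV X Y Z.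
Proof.
apply: (iso_epi (is_iso_assoc X Y Z)).
apply: (iso_mono (is_iso_assocV X Y Z)).
have hl : braid X (Y \ox Z) \oc assoc X Y Z =
    assocV Y Z X \oc ((idm Y \om braid X Z) \oc assoc Y X Z \oc (braid X Y \om idm Z)).
  by rewrite -hexagon_l !comp_assoc assocVA comp_idl.
have hr : assocV X Y Z \oc braid (Y \ox Z) X =
    (braid Y X \om idm Z) \oc assocV Y X Z \oc (idm Y \om braid Z X) \oc assoc Y Z X.
  by rewrite -hexagon_r -!comp_assoc assocVA comp_idr.
rewrite !monodromyE -(comp_assoc (braid _ _)) hl !comp_assoc hr assocVA comp_idl.
rewrite -!(comp_assoc _ (assocV X Y Z)) assocVA comp_idr.
rewrite -(comp_assoc _ (assoc Y Z X)) assocAV comp_idr.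
by rewrite tensm_compr !comp_assoc.
Qed.

Lemma monodromy_tens_trivial X Y Z :
  monodromy X Z = idm (X \ox Z) ->
  monodromy X (Y \ox Z) =
  assoc X Y Z \oc (monodromy X Y \om idm Z) \oc assocV X Y Z.
Proof.
move=> XZ; rewrite monodromy_tens XZ tensm_id comp_idr.
rewrite -(comp_assoc _ (assocV Y X Z)) assocVA comp_idr.
by rewrite monodromyE tensm_compl !comp_assoc.
Qed.

(* Up to [runit], [X |-> monodromy X 1] is a natural automorphism [n] of the  *)
(* identity functor; the hexagons give [n \oc n = n].                         *)
Lemma monodromy_unit X : monodromy X unit_obj = idm (X \ox unit_obj).
Proof.
pose n Y := runit Y \oc monodromy Y unit_obj \oc runitV Y.
have runitKl Y : runitV Y \oc runit Y = idm _ by case: (runitK Y).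
have n_nat Y Z (f : hom Y Z) : n Z \oc f = f \oc n Y.
  apply: (iso_epi (is_iso_runit _)).
  rewrite -(comp_assoc (n Z)) -runit_natural /n.
  rewrite -!comp_assoc runitKl comp_idr !comp_assoc.
  rewrite -(comp_assoc _ (runitV Z)) runitKl comp_idr.
  rewrite -(comp_assoc _ (monodromy _ _)) monodromy_natural.
  by rewrite comp_assoc runit_natural.
have n_tensl Y : idm unit_obj \om n Y = n (unit_obj \ox Y).
  by apply: (iso_mono (is_iso_lunit _)); rewrite lunit_natural n_nat.
have n_tensr Y : n Y \om idm unit_obj = n (Y \ox unit_obj).
  by apply: (iso_mono (is_iso_runit _)); rewrite runit_natural n_nat.
have m_n Y : monodromy Y unit_obj = n (Y \ox unit_obj).
  apply: (iso_mono (is_iso_runit _)); rewrite -n_nat /n.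
  by rewrite -!comp_assoc runitKl comp_idr.
have n_iso Y : is_iso (n Y).
  apply: is_iso_comp (is_iso_runitV _).
  exact: is_iso_comp (is_iso_runit _) (is_iso_monodromy _ _).
clearbody n.
have l_iso : is_iso (idm X \om lunit (unit_obj : C)).
  exact: is_iso_tensm (is_iso_id _) (is_iso_lunit _).
have m_n2 : monodromy X (unit_obj \ox unit_obj) = n _.
  apply: (iso_mono l_iso).
  by rewrite -monodromy_natural m_n n_nat.
have nn : n (X \ox (unit_obj \ox unit_obj)) \oc n _ = n _.
  rewrite -{3}m_n2 monodromy_tens m_n n_tensl.
  rewrite -n_nat -!comp_assoc; congr (_ \oc _).
  rewrite (comp_assoc (assocV _ _ _)) assocVA comp_idl (comp_assoc (_ \om _)).
  rewrite -tensm_compl -monodromyE m_n n_tensr n_nat.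
  by rewrite comp_assoc assocAV comp_idl.
have n1 : n (X \ox (unit_obj \ox unit_obj)) = idm _.
  by apply: (iso_mono (n_iso _)); rewrite nn comp_idr.
by apply: (iso_epi l_iso); rewrite m_n n_nat n1 comp_idl comp_idr.
Qed.

Definition centralizer (P : set C) : set C :=
  [set X | forall W, P W -> monodromy W X = idm (W \ox X)].

Lemma centralizerT : centralizer [set: C] = symmetric_center C.
Proof.
apply/predeqP => X; split=> [cX Y|cX W _].
  by rewrite -monodromyE; apply/monodromyC/cX.
by apply: monodromyC; rewrite monodromyE; apply: cX.
Qed.

Lemma centralizer_anti (P Q : set C) : P `<=` Q -> centralizer Q `<=` centralizer P.
Proof. by move=> PQ X cX W /PQ; apply: cX. Qed.

Variable P : set C.

Lemma centralizer_retract X Y (i : hom X Y) (r : hom Y X) :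
  r \oc i = idm X -> centralizer P Y -> centralizer P X.
Proof.
move=> ri cY W PW.
have i_mono : mono (idm W \om i).
  apply: (split_mono (g := idm W \om r)).
  by rewrite -tensm_compr ri tensm_id.
by apply: i_mono; rewrite -monodromy_natural cY // comp_idl comp_idr.
Qed.

Lemma centralizer_fusion : fusion_subcategory (centralizer P).
Proof.
split.
- by move=> W _; apply: monodromy_unit.
- move=> X Y cX cY W PW; rewrite monodromy_tens_trivial; last exact: cY.
  by rewrite cX // tensm_id comp_idr assocAV.
- move=> n s X [inj [prj [prj_inj _ sum_id]]]; split=> [cX i|cs W PW].
    exact: centralizer_retract (prj_inj i) cX.
  rewrite -(comp_idr (monodromy W X)) -tensm_id -sum_id tensm_sumr comp_sumr.
  apply: eq_bigr => i _.
  by rewrite tensm_compr comp_assoc monodromy_natural cs // comp_idr.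
- move=> X Y [ev [coev dualXY]] cX W PW.
  apply: (ev_nondegenerate dualXY).
  apply: (iso_epi (is_iso_assocV W Y X)).
  rewrite tensm_id comp_idr -!comp_assoc assocAV comp_idr.
  rewrite (comp_assoc (assoc _ _ _)) -monodromy_tens_trivial; last exact: cX.
  by rewrite -monodromy_natural monodromy_unit comp_idl.
- move=> X Y [ev [coev dualYX]] cX W PW.
  apply: (coev_nondegenerate dualYX).
  apply: (iso_mono (is_iso_assoc W Y X)).
  rewrite tensm_id comp_idl !comp_assoc assocAV comp_idl.
  rewrite -monodromy_tens_trivial; last exact: cX.
  by rewrite monodromy_natural monodromy_unit comp_idr.
Qed.

End Braided.

Section FusionSubcategory.
Variables (K : fieldType) (C : monoidalCategory K).
Hypotheses (C_ab : abelian_category C) (C_ss : semisimple_category C).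
Variable P : set C.
Hypothesis fP : fusion_subcategory P.
Implicit Types X Y Z W : C.

Lemma subcat_iso X Y : isomorphic X Y -> P X -> P Y.
Proof.
by move=> XY PX; apply/(subcat_sum fP (direct_sum1 XY)).
Qed.

Lemma subcat_simple_quotient X Y (f : hom X Y) :
  simple_obj Y -> f <> 0 -> P X -> P Y.
Proof.
move=> Ys fn0 PX; have [n [s [s_simple sX]]] := C_ss X.
have [i [j fj]] := direct_sum_nonzero_to sX fn0.
apply: (subcat_iso (X := s i)); last by move: i {j fj}; apply/(subcat_sum fP sX).
by exists (f \oc j); apply: schur.
Qed.

Lemma subcat_eqT : (forall X, simple_obj X -> P X) -> P = [set: C].
Proof.
move=> all_simple; apply/predeqP => X; split=> // _.
have [n [s [s_simple sX]]] := C_ss X.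
by apply/(subcat_sum fP sX) => i; apply: all_simple.
Qed.

Lemma simple_full (X : full_linear P) : simple_obj X <-> simple_obj (sval X).
Proof.
have zero_full (Y : full_linear P) : is_zero Y <-> is_zero (sval Y).
  by rewrite !is_zeroE.
split=> [[Xn0 Xs]|[Xn0 Xs]].
  have [n [s [s_simple sX]]] := C_ss (sval X).
  have Ps i : P (s i) by move: i; apply/(subcat_sum fP sX)/svalP.
  have [inj [prj [prj_inj _ sum_id]]] := sX.
  have [i _|s_empty] := pickP (fun _ : 'I_n => true); last first.
    case: Xn0; apply/is_zeroE; rewrite -[LHS]sum_id big1 // => i _.
    by have := s_empty i.
  pose S : full_linear P := exist _ (s i) (Ps i).
  have [S0|inj_iso] := Xs S (inj i) (@split_mono _ (full_linear P) S X _ _ (prj_inj i)).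
    by case: (s_simple i) => sn0; case: sn0; apply/(zero_full S).
  by apply: simple_iso (s_simple i); exists (inj i).
split=> [/zero_full //|Y f f_mono].
have [n [s [s_simple sY]]] := C_ss (sval Y).
have Ps i : P (s i) by move: i; apply/(subcat_sum fP sY)/svalP.
pose S i : full_linear P := exist _ (s i) (Ps i).
have [inj [prj [prj_inj prj_inj0 sum_id]]] := sY.
pose fi i : hom (s i) (sval X) := (f : hom (sval Y) (sval X)) \oc inj i.
have fi_iso i : is_iso (fi i).
  apply: schur => // fi0; have [sn0 _] := s_simple i; apply: sn0; apply/is_zeroE.
  rewrite -prj_inj; suff -> : inj i = 0 by rewrite comp0r.
  by apply: (f_mono (S i) (inj i) 0); rewrite [LHS]fi0 comp0r.
have [i _|s_empty] := pickP (fun _ : 'I_n => true); last first.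
  left; apply/is_zeroE; rewrite -[LHS]sum_id big1 // => i _.
  by have := s_empty i.
right; have one j : j = i.
  apply/eqP; apply: contrapT => /negP ji; have [fj' [_ fjK]] := fi_iso j.
  have eq_inj : inj i = inj j \oc (fj' \oc fi i).
    apply: (f_mono (S i) (inj i) (inj j \oc (fj' \oc fi i))).
    change (fi i = (f : hom (sval Y) (sval X)) \oc (inj j \oc (fj' \oc fi i))).
    by rewrite comp_assoc -/(fi j) comp_assoc fjK comp_idl.
  have [sn0 _] := s_simple i; apply: sn0; apply/is_zeroE.
  by rewrite -prj_inj eq_inj comp_assoc prj_inj0 // comp0l.
have inj_prj : inj i \oc prj i = idm (sval Y).
  rewrite -sum_id (bigD1 i) //= big1 ?addr0 // => j /eqP; by rewrite (one j).
have [g [gK fK]] := fi_iso i.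
exists (inj i \oc g); split.
  change ((inj i \oc g) \oc (f : hom (sval Y) (sval X)) = idm (sval Y)).
  have -> : f = fi i \oc prj i by rewrite /fi -comp_assoc inj_prj comp_idr.
  by rewrite -comp_assoc (comp_assoc g) gK comp_idl.
by change ((f : hom (sval Y) (sval X)) \oc (inj i \oc g) = idm (sval X));
  rewrite comp_assoc.
Qed.

Lemma rank_full n (s : 'I_n -> C) :
  (forall i, simple_obj (s i)) ->
  (forall i j, isomorphic (s i) (s j) -> i = j) ->
  (forall X, simple_obj X -> exists i, isomorphic X (s i)) ->
  rank (full_linear P) = #|[pred i | `[< P (s i) >]]|.
Proof.
move=> s_simple s_inj s_all; apply: rank_eq.
set A := [pred i | _].
have PA (k : 'I_#|A|) : P (s (enum_val k)) by have /asboolP := enum_valP k.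
exists (fun k => exist _ _ (PA k)); split=> [k|k l kl|X Xs].
- exact: (proj2 (simple_full (exist _ _ (PA k))) (s_simple _)).
- exact: enum_val_inj (s_inj _ _ kl).
have [i Xi] := s_all _ (proj1 (simple_full X) Xs).
have Ai : i \in A by apply/asboolP; apply: subcat_iso Xi (svalP X).
exists (enum_rank_in Ai i).
suff XE : isomorphic (sval X) (s (enum_val (enum_rank_in Ai i))) by [].
by rewrite enum_rankK_in.
Qed.

End FusionSubcategory.

Lemma tannakian_symmetric (K : fieldType) (C : braidedCategory K) (D : set C) :
  tannakian D -> D `<=` centralizer D.
Proof.
move=> [fD [gT [F [[G [eta [_ [eta_iso _ eta_nat _]]]] [mu]]]]] X DX Y DY.
pose X' : full_braided fD := exist _ X DX.
pose Y' : full_braided fD := exist _ Y DY.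
rewrite monodromyE.
suff : (braid X' Y' \oc braid Y' X' : hom (Y' \ox X') (Y' \ox X')) = idm _ by [].
have F_faithful A B (f g : hom A B) : fmor F f = fmor F g -> f = g.
  by move=> fg; apply: (iso_mono (eta_iso B)); rewrite !eta_nat fg.
apply: F_faithful; apply: (iso_epi (fmu_iso mu Y' X')).
rewrite fmor_comp fmor_id comp_idl -comp_assoc fmu_braid comp_assoc fmu_braid.
rewrite -comp_assoc.
suff -> : braid (F X') (F Y') \oc braid (F Y') (F X') = idm _ by rewrite comp_idr.
apply: rep_hom_eq; rewrite /= reidx_comp reidx_id //.
exact: idx_swapK.
Qed.

Section Fusion.
Variables (K : fieldType) (C : monoidalCategory K).
Hypothesis C_fus : fusion_category C.
Implicit Types X Y V : C.

Let C_ab := fusion_abelian C_fus.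
Let C_ss := fusion_semisimple C_fus.

Lemma unit_retract X Y : left_dual X Y -> ~ is_zero X ->
  exists (i : hom unit_obj (Y \ox X)) (r : hom (Y \ox X) unit_obj),
    r \oc i = idm unit_obj.
Proof.
move=> [ev [coev dualXY]] Xn0; have [n [s [s_simple sYX]]] := C_ss (Y \ox X).
have [k [j evj]] := direct_sum_nonzero_to sYX (ev_neq0 dualXY Xn0).
have [g [_ fg]] := schur C_ab (s_simple k) (fusion_unit_simple C_fus) evj.
by exists (j \oc g), ev; rewrite comp_assoc.
Qed.

Lemma tens_retract X Y V : left_dual X Y -> ~ is_zero X ->
  exists (i : hom V (Y \ox (X \ox V))) (r : hom (Y \ox (X \ox V)) V),
    r \oc i = idm V.
Proof.
move=> XY Xn0; have [i [r ri]] := unit_retract XY Xn0.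
exists (assoc Y X V \oc (i \om idm V) \oc lunitV V).
exists (lunit V \oc (r \om idm V) \oc assocV Y X V).
rewrite -!comp_assoc (comp_assoc (assocV _ _ _)) assocVA comp_idl.
rewrite (comp_assoc (r \om _)) -tensm_compl ri tensm_id comp_idl.
by case: (lunitK V).
Qed.

Lemma subcat_left_factor (P : set C) X V T (g : hom T (X \ox V)) :
  fusion_subcategory P -> simple_obj X -> g <> 0 -> P V -> P T -> P X.
Proof.
move=> fP Xs gn0 PV PT; have [_ [U UV]] := fusion_rigid C_fus V.
have [ev [coev dualUV]] := UV.
pose f := runit X \oc ((idm X \om ev) \oc assoc X V U \oc (g \om idm U)).
apply: (subcat_simple_quotient C_ab C_ss fP (f := f)) => //.
  move=> f0; apply: gn0; apply: (ev_nondegenerate dualUV).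
  apply: (iso_mono (is_iso_runit X)).
  by rewrite [LHS]f0 tensm0l !comp0r.
by apply: (subcat_tens fP) => //; apply: (subcat_rdual fP UV).
Qed.

End Fusion.

Lemma symmetric_subcat_in_center (K : fieldType) (C : braidedCategory K)
    (D : set C) (X Y : C) :
  fusion_category C -> fusion_subcategory D -> D `<=` centralizer D ->
  simple_obj X -> centralizer [set: C] X -> ~ D X ->
  (forall S, simple_obj S -> [\/ D S, isomorphic S X | isomorphic S Y]) ->
  D `<=` centralizer [set: C].
Proof.
move=> C_fus fD D_sym Xs ZX nDX simples V DV.
have C_ab := fusion_abelian C_fus; have C_ss := fusion_semisimple C_fus.
have fZ := centralizer_fusion [set: C]; have fc := centralizer_fusion D.
have cX : centralizer D X by apply: centralizer_anti ZX.
have [cY|ncY] := pselect (centralizer D Y).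
  have cT : centralizer D = [set: C].
    apply: (subcat_eqT C_ss fc) => S /simples[/D_sym //| |] /isomorphic_sym.
      by move=> /(subcat_iso fc); apply.
    by move=> /(subcat_iso fc); apply.
  move=> W _; apply: monodromyC.
  by have : centralizer D W by [rewrite cT]; apply.
have ZXV : centralizer [set: C] (X \ox V).
  have [n [s [s_simple sXV]]] := C_ss (X \ox V).
  apply/(subcat_sum fZ sXV) => i.
  have csi : centralizer D (s i).
    move: i; apply/(subcat_sum fc sXV).
    by apply: (subcat_tens fc) => //; apply: D_sym.
  have [Ds|/isomorphic_sym sX|sY] := simples _ (s_simple i); last first.
  - by case: ncY; apply: (subcat_iso fc sY).
  - exact: (subcat_iso fZ sX).
  case: nDX; have [inj [prj [prj_inj _ _]]] := sXV.
  apply: (subcat_left_factor (g := inj i) C_fus fD) => // inj0.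
  have [sn0 _] := s_simple i; apply: sn0; apply/is_zeroE.
  by rewrite -prj_inj inj0 comp0r.
have [[X' XX'] _] := fusion_rigid C_fus X.
have [i [r ri]] := tens_retract C_fus V XX' (proj1 Xs).
apply: centralizer_retract ri _.
by apply: (subcat_tens fZ) => //; apply: (subcat_ldual fZ XX').
Qed.

Theorem lemma5p3 (R : realType) (C : premodularCategory (complex R))
    (D : set C) (tanD : tannakian D)
    (rankD : (rank (full_linear D) + 2)%N = rank C) :
  [\/ symmetric_center C = [set: C],
      D `<` symmetric_center C /\
        maximal_fusion_subcategory (symmetric_center C)
    | symmetric_center C `<=` D].
Proof.
have C_fus := pm_fusion C.
have C_ab := fusion_abelian C_fus; have C_ss := fusion_semisimple C_fus.
have fZ := centralizer_fusion [set: C].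
have D_sym := tannakian_symmetric tanD; have [fD _] := tanD.
have [n nP] := fusion_finite C_fus; have rankC := rank_eq nP.
have [s [s_simple s_inj s_all]] := nP.
have rankE P (fP : fusion_subcategory P) :=
  rank_full C_ab C_ss fP s_simple s_inj s_all.
rewrite -centralizerT.
have [[i0 [Zi0 Di0]]|ZD] :=
    pselect (exists i, centralizer [set: C] (s i) /\ ~ D (s i)); last first.
  apply: Or33 => X ZX; have [m [t [t_simple tX]]] := C_ss X.
  apply/(subcat_sum fD tX) => j; have [i ti] := s_all _ (t_simple j).
  apply: (subcat_iso fD (isomorphic_sym ti)).
  apply: contrapT => Di; case: ZD; exists i; split=> //.
  by apply: (subcat_iso fZ ti); move: j {ti}; apply/(subcat_sum fZ tX).
pose A := [pred i | `[< D (s i) >]].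
have cardA : (#|A| + 2)%N = n by apply: etrans (etrans rankD rankC); rewrite rankE.
have Ai0 : i0 \notin A by apply/asboolP.
have [i1 i1P] : exists i1, [predD1 predC A & i0] =i pred1 i1.
  apply/card1P; rewrite -(eqn_add2l (i0 \in predC A)) -cardD1.
  by rewrite -(eqn_add2l #|A|) cardC card_ord inE /= Ai0 cardA.
have simples S : simple_obj S -> [\/ D S, isomorphic S (s i0) | isomorphic S (s i1)].
  move=> /s_all[i Si]; have [Di|nDi] := pselect (D (s i)).
    by apply: Or31; apply: (subcat_iso fD (isomorphic_sym Si)).
  have [<-|ii0] := eqVneq i i0; first exact: Or32.
  have := i1P i; rewrite !inE ii0 /= => /esym.
  by case: asboolP => // _ /eqP <-; apply: Or33.
have DZ : D `<=` centralizer [set: C].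
  exact: (symmetric_subcat_in_center C_fus fD D_sym (s_simple i0) Zi0 Di0 simples).
have [Zi1|nZi1] := pselect (centralizer [set: C] (s i1)).
  apply: Or31; apply: (subcat_eqT C_ss fZ) => S /simples[/DZ //| |] /isomorphic_sym.
    by move=> /(subcat_iso fZ); apply.
  by move=> /(subcat_iso fZ); apply.
apply: Or32; split; first by split=> // /(_ _ Zi0).
split=> //; first by split=> // /(_ (s i1) Logic.I).
apply: etrans (etrans cardA (esym rankC)).
have -> : (#|A| + 2 = #|[predU1 i0 & A]| + 1)%N.
  by rewrite cardU1 Ai0 add1n addn1 addn2.
congr (_ + _)%N; rewrite rankE //.
apply: eq_card => i; rewrite !inE; apply/asboolP/orP.
  move=> Zi; have [|Di] := pselect (D (s i)); [by right; apply/asboolP|left].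
  apply: contrapT => /negP ii0; apply: nZi1.
  have := i1P i; rewrite !inE ii0 /= => /esym.
  by case: asboolP => // _ /eqP <-.
by case=> [/eqP -> //|/asboolP]; apply: DZ.
Qed.
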